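(* Let $G$ be a torsion nilpotent group and let $\phi$ be an endomorphism of $G$ with $h(\phi)<\infty$. Then $h(\phi)=\log(\alpha)$ for some positive integer $\alpha$.
   Context: Algebraic entropy: for a group $G$, an endomorphism $\phi$ of $G$ and a non-empty finite subset $F\subseteq G$, put $T_n(\phi,F)=F\,\phi(F)\cdots\phi^{n-1}(F)$ (product of subsets) for each integer $n\ge 1$, and $H(\phi,F)=\limsup_{n\to\infty}\frac1n\log|T_n(\phi,F)|$ (in fact a limit). The algebraic entropy of $\phi$ is $h(\phi)=\sup_F H(\phi,F)\in[0,\infty]$, where $F$ ranges over all non-empty finite subsets of $G$. A group is torsion if each of its elements has finite order. *)

(* Defs.v *)
From HB Require Import structures.
From mathcomp Require Import all_boot all_order all_algebra finmap.
From mathcomp Require Import all_classical all_reals all_analysis.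

Set Implicit Arguments.
Unset Strict Implicit.
Unset Printing Implicit Defensive.

Import Order.TTheory GRing.Theory Num.Theory.

Local Open Scope classical_set_scope.
Local Open Scope fset_scope.
Local Open Scope ring_scope.

Section Groups.
Variable G : groupType.

Definition torsion := forall x : G, exists2 n : nat, (0 < n)%N & (x ^+ n = 1)%g.

(* Upper central series: Z_0 = 1 and Z_(n+1) / Z_n is the center of G / Z_n,
   i.e. Z_(n+1) consists of the x that commute with every y modulo Z_n. *)
Fixpoint upper_central (n : nat) : set G :=
  if n is n'.+1 then [set x : G | forall y : G, upper_central n' [~ x, y]%g]
  else [set 1%g].

Definition nilpotent_group := exists n : nat, upper_central n = setT.

End Groups.

Section AlgebraicEntropy.
Variables (R : realType) (G : groupType) (phi : {multiplicative G -> G}).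
Implicit Types F : {fset G}.

Definition fset_mulg (A B : {fset G}) : {fset G} :=
  [fset (x * y)%g | x in A, y in B].

Definition trajectory F (n : nat) : {fset G} :=
  \big[fset_mulg / [fset 1%g]]_(i < n) [fset iter i phi x | x in F].

(* The term at n = 0 (which is 0, division by 0 being total) does not affect
   the limsup. *)
Definition entropy_at F : \bar R :=
  limn_esup (fun n : nat => (ln (#|` trajectory F n|%:R : R) / n%:R)%:E).

Definition algebraic_entropy : \bar R :=
  ereal_sup [set entropy_at F | F in [set F : {fset G} | F != fset0]].

End AlgebraicEntropy.

Arguments algebraic_entropy R {G} phi.
Arguments entropy_at R {G} phi F.

(* Main.v *)
Require Import Defs.
From HB Require Import structures.
From mathcomp Require Import all_boot all_order all_algebra finmap.
From mathcomp Require Import all_classical all_reals all_analysis.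

(** Write [T_n(F)] for the trajectory of [F]. The entropy turns out to be the
    supremum of numbers [ln m] with [m] a positive integer; when that supremum
    is finite it is attained, because only finitely many integers stay below
    its exponential. So it suffices to put every finite set [F0] inside a
    finite set [F] with [m ^ n <= |T_n(F)| <= C * m ^ n] for all large [n], where
    [m] is an integer.

    The upper bound comes from a finite set [S] and a rank [k] such that
    [T_(k+1)(F)] is contained in [T_k(F) phi^k(S)]. Applying powers of [phi]
    and multiplying on the left propagates this inclusion to all larger ranks,
    so each further step multiplies the size by at most [|S|]. The lower bound
    asks for [|S| ^ n] elements of [T_n(F)]. Both conditions make sense modulo
    a normal [phi]-stable subgroup [L]; call [L] tame when every finite set
    lies in such an [F]. The whole group is tame for trivial reasons, and the
    goal is to reach the trivial subgroup.

    The descent runs along a central series of [phi]-stable subgroups. The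
    terms [Z_i] of the upper central series need not be [phi]-stable, but the
    sets of those [x] whose whole [phi]-orbit lies in [Z_i] are, and the
    commutators behave in the same way ([stable_central_comm]).

    Descent from [K] to [L], where [[G, K]] is contained in [L]
    ([tame_central_extension]): take [F1] and [S1] modulo [K]. The inclusion
    for [F1] holds up to finitely many correcting factors, all in [K]. Since
    [K / L] is abelian and torsion, these lie in a finite set [E] that is a
    subgroup modulo [L] ([finite_subgroup_mod]); for such an [E] the trajectory
    is an increasing chain of subgroups and a transversal provides a sharp [S2]
    ([finite_subgroup_growth]). As [E] is central modulo [L], the trajectory of
    the product [F1 E] is the product of the two trajectories, so the
    corrections are absorbed by the factor [E], and [F1 E] and [S1 S2] satisfy
    both conditions modulo [L]. The point is that the corrections are local in
    the index of the trajectory: no commutator between far apart iterates of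
    [phi] ever has to be controlled. *)

Import Order.TTheory GRing.Theory Num.Theory.

Local Open Scope ring_scope.

Set Implicit Arguments.
Unset Strict Implicit.
Unset Printing Implicit Defensive.

(** * Products of finite subsets of a group *)

Section FsetProduct.
Variable G : groupType.
Implicit Types (A B C : {fset G}) (x y : G).
Local Open Scope group_scope.
Local Open Scope fset_scope.

Lemma mem_fset_mulgP A B x :
  reflect (exists2 a, a \in A & exists2 b, b \in B & x = a * b)
          (x \in fset_mulg A B).
Proof. exact: imfset2P. Qed.

Lemma mem_fset_mulg A B a b :
  a \in A -> b \in B -> a * b \in fset_mulg A B.
Proof. by move=> aA bB; apply/mem_fset_mulgP; exists a => //; exists b. Qed.

Lemma fset_mulgA : associative (@fset_mulg G).
Proof.
move=> A B C; apply/fsetP => x; apply/idP/idP.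
  case/mem_fset_mulgP => a aA [y /mem_fset_mulgP [b bB [c cC ->]] ->].
  by rewrite mulgA; do !apply: mem_fset_mulg.
case/mem_fset_mulgP => y /mem_fset_mulgP [a aA [b bB ->]] [c cC ->].
by rewrite -mulgA; do !apply: mem_fset_mulg.
Qed.

Lemma fset_mul1g : left_id [fset 1] (@fset_mulg G).
Proof.
move=> A; apply/fsetP => x; apply/idP/idP => [|xA].
  by case/mem_fset_mulgP => a /fset1P -> [b bA ->]; rewrite mul1g.
by rewrite -(mul1g x) mem_fset_mulg ?inE.
Qed.

Lemma fset_mulg1 : right_id [fset 1] (@fset_mulg G).
Proof.
move=> A; apply/fsetP => x; apply/idP/idP => [|xA].
  by case/mem_fset_mulgP => a aA [b /fset1P -> ->]; rewrite mulg1.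
by rewrite -(mulg1 x) mem_fset_mulg ?inE.
Qed.

HB.instance Definition _ :=
  Monoid.isLaw.Build {fset G} [fset 1] (@fset_mulg G)
    fset_mulgA fset_mul1g fset_mulg1.

Lemma card_fset_mulgE A B :
  #|` fset_mulg A B| = size (undup [seq (x * y) | x <- A, y <- B]).
Proof.
have -> : fset_mulg A B =
    [fset z in [seq (x * y) | x <- enum_fset A, y <- enum_fset B]].
  apply/fsetP => x; rewrite inE /=; apply/mem_fset_mulgP/allpairsP.
    by case=> a aA [b bB ->]; exists (a, b).
  by case=> -[a b] /= [aA bB ->]; exists a => //; exists b.
by rewrite card_fseq.
Qed.

Lemma card_fset_mulg_le A B : (#|` fset_mulg A B| <= #|` A| * #|` B|)%N.
Proof.
by rewrite card_fset_mulgE (leq_trans (size_undup _))// size_allpairs.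
Qed.

Lemma card_fset_mulg_inj A B :
  (forall a a' b b', a \in A -> a' \in A -> b \in B -> b' \in B ->
     a * b = a' * b' -> a = a' /\ b = b') ->
  #|` fset_mulg A B| = (#|` A| * #|` B|)%N.
Proof.
move=> inj; rewrite card_fset_mulgE undup_id ?size_allpairs//.
apply: allpairs_uniq; rewrite ?fset_uniq//.
move=> [a b] [a' b'] /allpairsP[-[u v] /= [uA vB [-> ->]]].
move=> /allpairsP[-[u' v'] /= [uA' vB' [-> ->]]] e.
by have [-> ->] := inj _ _ _ _ uA uA' vB vB' e.
Qed.

End FsetProduct.

(** * Trajectories *)

Section Trajectory.
Variables (G : groupType) (phi : {multiplicative G -> G}).
Implicit Types (E F S : {fset G}) (x y : G) (n : nat).
Local Open Scope group_scope.
Local Open Scope fset_scope.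

Lemma iter_phiM n : {morph iter n phi : x y / x * y}.
Proof. by elim: n => // n IH x y; rewrite !iterS IH gmulfM. Qed.

Lemma iter_phi1 n : iter n phi 1 = 1.
Proof.
by apply: (mulgI (iter n phi 1)); rewrite -iter_phiM !mulg1.
Qed.

Lemma iter_phiV n : {morph iter n phi : x / x^-1}.
Proof.
move=> x; rewrite -(@mulg1_eq _ (iter n phi x) (iter n phi x^-1)) //.
by rewrite -iter_phiM mulgV iter_phi1.
Qed.

Lemma trajectory0 F : trajectory phi F 0 = [fset 1].
Proof. by rewrite /trajectory big_ord0. Qed.

Lemma trajectorySr F n :
  trajectory phi F n.+1 =
  fset_mulg (trajectory phi F n) [fset iter n phi x | x in F].
Proof. by rewrite /trajectory big_ord_recr. Qed.

Lemma trajectorySP F n x :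
  reflect (exists2 t, t \in trajectory phi F n &
             exists2 f, f \in F & x = t * iter n phi f)
          (x \in trajectory phi F n.+1).
Proof.
rewrite trajectorySr; apply: (iffP (mem_fset_mulgP _ _ _)).
  by case=> t tT [y /imfsetP[f /= fF ->] ->]; exists t => //; exists f.
case=> t tT [f fF ->]; exists t => //; exists (iter n phi f) => //.
by apply/imfsetP; exists f.
Qed.

Lemma mem_trajectoryS F n t f :
  t \in trajectory phi F n -> f \in F ->
  t * iter n phi f \in trajectory phi F n.+1.
Proof. by move=> tT fF; apply/trajectorySP; exists t => //; exists f. Qed.

Lemma trajectoryDP F m n x :
  reflect (exists2 t, t \in trajectory phi F m &
             exists2 u, u \in trajectory phi F n & x = t * iter m phi u)
          (x \in trajectory phi F (m + n)).
Proof.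
elim: n x => [|n IH] x.
  rewrite addn0; apply: (iffP idP) => [xT|].
    by exists x => //; exists 1; rewrite ?iter_phi1 ?mulg1// trajectory0 inE.
  by rewrite trajectory0 => -[t tT [u /fset1P -> ->]]; rewrite iter_phi1 mulg1.
rewrite addnS; apply: (iffP (trajectorySP _ _ _)).
  case=> _ /IH[t tT [u uT ->]] [f fF ->]; exists t => //.
  exists (u * iter n phi f); first exact: mem_trajectoryS.
  by rewrite iter_phiM -iterD mulgA.
case=> t tT [_ /trajectorySP[u uT [f fF ->]] ->].
exists (t * iter m phi u); first by apply/IH; exists t => //; exists u.
by exists f => //; rewrite iter_phiM -iterD mulgA.
Qed.

Lemma mem_trajectoryD F m n t u :
  t \in trajectory phi F m -> u \in trajectory phi F n ->
  t * iter m phi u \in trajectory phi F (m + n).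
Proof. by move=> tT uT; apply/trajectoryDP; exists t => //; exists u. Qed.

Lemma trajectory_sub E F n :
  E `<=` F -> trajectory phi E n `<=` trajectory phi F n.
Proof.
move=> EF; elim: n => [|n IH]; first by rewrite !trajectory0.
apply/fsubsetP => x /trajectorySP[t tE [f fE ->]].
by apply: mem_trajectoryS; [exact: (fsubsetP IH)|exact: (fsubsetP EF)].
Qed.

Lemma trajectory_neq0 F n : F != fset0 -> trajectory phi F n != fset0.
Proof.
move=> /fset0Pn[f fF]; elim: n => [|n /fset0Pn[t tT]].
  by rewrite trajectory0; apply/fset0Pn; exists 1; rewrite inE.
by apply/fset0Pn; exists (t * iter n phi f); apply: mem_trajectoryS.
Qed.

Lemma trajectory1 F n : 1 \in F -> 1 \in trajectory phi F n.
Proof.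
move=> F1; elim: n => [|n IH]; first by rewrite trajectory0 inE.
by rewrite -(mulg1 1) -{2}(iter_phi1 n); apply: mem_trajectoryS.
Qed.

(** The unit fills the other positions. *)
Lemma iter_mem_trajectory F n i f :
  1 \in F -> f \in F -> (i < n)%N -> iter i phi f \in trajectory phi F n.
Proof.
move=> F1 fF; elim: n => // n IH; rewrite ltnS leq_eqVlt => /orP[/eqP ->|lin].
  rewrite -(mul1g (iter n phi f)); apply: mem_trajectoryS => //.
  exact: trajectory1.
rewrite -(mulg1 (iter i phi f)) -(iter_phi1 n).
by apply: mem_trajectoryS => //; exact: IH.
Qed.

Lemma trajectory_shift F n t :
  1 \in F -> t \in trajectory phi F n -> phi t \in trajectory phi F n.+1.
Proof.
move=> F1 tT; rewrite -(mul1g (phi t)) -(addn1 n) addnC -[phi t]/(iter 1 phi t).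
by apply: mem_trajectoryD => //; exact: trajectory1.
Qed.

End Trajectory.

(** * Congruence modulo a stable normal subgroup *)

Section Congruence.
Variables (G : groupType) (phi : {multiplicative G -> G}).
Implicit Types (K L : set G) (A B U : {fset G}) (x y z : G).
Local Open Scope group_scope.

Record stable_normal L : Prop := StableNormal {
  stable_normal1 : L 1;
  stable_normalM : forall x y, L x -> L y -> L (x * y);
  stable_normalV : forall x, L x -> L x^-1;
  stable_normalJ : forall x y, L x -> L (x ^ y);
  stable_normal_phi : forall x, L x -> L (phi x) }.

Definition eqmod L x y := L (x^-1 * y).

(** Membership in the product [A L]. Quotient groups are avoided by carrying a
    congruence along, so that all finite sets live in [G]. *)
Definition mem_mod L A x := exists2 a, a \in A & eqmod L x a.

Definition separated L U :=
  forall x y, x \in U -> y \in U -> eqmod L x y -> x = y.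

Section Laws.
Variable L : set G.
Hypothesis nL : stable_normal L.

Lemma eqmod_refl x : eqmod L x x.
Proof. by rewrite /eqmod mulVg; exact: stable_normal1. Qed.

Lemma eqmod_eq x y : x = y -> eqmod L x y.
Proof. by move=> ->; exact: eqmod_refl. Qed.

Lemma eqmod_sym x y : eqmod L x y -> eqmod L y x.
Proof.
by rewrite /eqmod => /(stable_normalV nL); rewrite invgM invgK.
Qed.

Lemma eqmod_trans y x z : eqmod L x y -> eqmod L y z -> eqmod L x z.
Proof.
by move=> xy yz; have := stable_normalM nL xy yz; rewrite mulgA mulgK.
Qed.

Lemma eqmodM x x' y y' :
  eqmod L x x' -> eqmod L y y' -> eqmod L (x * y) (x' * y').
Proof.
move=> xx' yy'; have := stable_normalM nL (stable_normalJ nL y xx') yy'.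
by rewrite /eqmod /conjg invgM !mulgA mulgK.
Qed.

Lemma eqmodMl x y y' : eqmod L y y' -> eqmod L (x * y) (x * y').
Proof. by apply: eqmodM; exact: eqmod_refl. Qed.

Lemma eqmodMr x x' y : eqmod L x x' -> eqmod L (x * y) (x' * y).
Proof. by move=> ?; apply: eqmodM => //; exact: eqmod_refl. Qed.

Lemma eqmod_iter n x y :
  eqmod L x y -> eqmod L (iter n phi x) (iter n phi y).
Proof.
rewrite /eqmod -iter_phiV -iter_phiM.
by elim: n => //= n IH /IH; exact: stable_normal_phi.
Qed.

Lemma mem_mod_refl A a : a \in A -> mem_mod L A a.
Proof. by move=> aA; exists a => //; exact: eqmod_refl. Qed.

Lemma mem_mod_eqmod A x y : eqmod L x y -> mem_mod L A y -> mem_mod L A x.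
Proof. by move=> xy [a aA ya]; exists a => //; exact: eqmod_trans ya. Qed.

(** A set of pairwise incongruent elements can be moved inside [A] by choosing
    representatives; this keeps later counts inside genuine trajectories, as is
    necessary before passing to a smaller subgroup. *)
Lemma separated_lift U A : separated L U ->
  (forall u, u \in U -> mem_mod L A u) -> exists U' : {fset G},
  [/\ (U' `<=` A)%fset, separated L U' & #|` U'| = #|` U| ].
Proof.
move=> sep UA.
have /choice[f fP] u : exists a, u \in U -> a \in A /\ eqmod L u a.
  have [/UA[a aA ua]|nu] := boolP (u \in U); first by exists a.
  by exists 1.
have inj u v : u \in U -> v \in U -> eqmod L (f u) (f v) -> u = v.
  move=> uU vU fuv; apply: sep => //.
  have [_ uf] := fP _ uU; have [_ /eqmod_sym vf] := fP _ vU.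
  exact: eqmod_trans uf (eqmod_trans fuv vf).
exists (f @` U)%fset; split.
- by apply/fsubsetP => a /imfsetP[u /= uU ->]; case: (fP _ uU).
- move=> a b /imfsetP[u /= uU ->] /imfsetP[v /= vU ->] fuv.
  by rewrite (inj _ _ uU vU fuv).
- apply/eqP/card_in_imfsetP => u v uU vU fuv.
  by apply: inj => //; exact: eqmod_eq.
Qed.

End Laws.

End Congruence.

(** * Two finiteness lemmas *)

(** Greedy choice: an element is kept when it is unrelated to all those already
    kept. *)
Lemma seq_transversal (T : choiceType) (E : seq T) (r : T -> T -> Prop) :
  (forall x, r x x) -> (forall x y, r x y -> r y x) ->
  exists S : {fset T}, [/\ {subset S <= E},
    forall e, e \in E -> exists2 s, s \in S & r s e &
    forall s s', s \in S -> s' \in S -> r s s' -> s = s'].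
Proof.
move=> rxx rsym; elim: E => [|x E [S [SE cov sepS]]].
  by exists fset0; split.
have [[s sS rsx]|nx] := pselect (exists2 s, s \in S & r s x).
  exists S; split=> // [y /SE|e]; first by rewrite inE orbC => ->.
  by rewrite inE => /orP[/eqP ->|/cov//]; exists s.
exists (x |` S)%fset; split=> [y|e|s s'].
- by rewrite !inE => /orP[->//|/SE ->]; rewrite orbT.
- rewrite inE => /orP[/eqP ->|/cov[s sS rse]].
    by exists x => //; rewrite !inE eqxx.
  by exists s => //; rewrite !inE sS orbT.
- rewrite !inE => /orP[/eqP ->|sS] /orP[/eqP ->|s'S] rss' //.
  + by case: nx; exists s' => //; exact: rsym.
  + by case: nx; exists s.
  + exact: sepS.
Qed.

Lemma uniform_bound (T : eqType) (E : seq T) (P : T -> nat -> Prop) :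
  (forall x m n, (m <= n)%N -> P x m -> P x n) ->
  (forall x, x \in E -> exists n, P x n) ->
  exists n, forall x, x \in E -> P x n.
Proof.
move=> mono; elim: E => [_|x E IH ex]; first by exists 0%N.
have [m Pm] := ex x (mem_head x E).
have [|n Pn] := IH; first by move=> y yE; apply: ex; rewrite inE yE orbT.
exists (maxn m n) => y; rewrite inE => /orP[/eqP ->|/Pn].
  exact: mono (leq_maxl m n) Pm.
exact: mono (leq_maxr m n).
Qed.

(** * Finite sets of sharp exponential growth *)

Section Growth.
Variables (G : groupType) (phi : {multiplicative G -> G}).
Implicit Types (L : set G) (F S : {fset G}).
Local Open Scope group_scope.

(** The last letter of a word of length [k + 1] can be replaced by a letter of
    [S], at the cost of changing the earlier ones: this bounds the growth ratio
    by [#|` S|]. *)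
Definition pushes L F S k := forall x, x \in trajectory phi F k.+1 ->
  exists2 t, t \in trajectory phi F k &
    exists2 s, s \in S & eqmod L x (t * iter k phi s).

(** The growth of the trajectory modulo [L] is at least that of [#|` S| ^ n].
    The representatives are required to lie in the trajectory itself, not just
    in it modulo [L]. *)
Definition grows L F S := forall n, exists U : {fset G},
  [/\ separated L U, (#|` S| ^ n <= #|` U|)%N &
      (U `<=` trajectory phi F n)%fset].

Definition tame L := forall F0 : {fset G}, exists F S : {fset G},
  [/\ (F0 `<=` F)%fset, exists k, pushes L F S k & grows L F S].

(** A word of length [j + k + 1] ends with the image under [phi^j] of one of
    length [k + 1], to which the hypothesis applies. *)
Lemma pushesD L F S k : stable_normal phi L -> pushes L F S k ->
  forall j, pushes L F S (j + k).
Proof.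
move=> nL push j x; rewrite -addnS => /trajectoryDP[t tT [u /push]].
move=> [v vT [s sS uvs]] ->; exists (t * iter j phi v).
  exact: mem_trajectoryD.
exists s => //; rewrite iterD -mulgA -iter_phiM.
by apply: (eqmodMl nL); exact: eqmod_iter.
Qed.

End Growth.

(** * Central layers *)

Section CentralLayer.
Variables (G : groupType) (phi : {multiplicative G -> G}) (K L : set G).
Implicit Types (D E S : {fset G}) (x y : G).
Hypothesis torsG : torsion G.
Hypothesis nK : stable_normal phi K.
Hypothesis nL : stable_normal phi L.
Local Open Scope group_scope.
Hypothesis central : forall x y, K x -> L [~ x, y].

Lemma central_commute x y : K x -> eqmod L (y * x) (x * y).
Proof. by move=> /central; rewrite /eqmod invgM -mulgA; exact. Qed.

Lemma stable_iter n x : K x -> K (iter n phi x).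
Proof. by elim: n => // n IH /IH /(stable_normal_phi nK). Qed.

Lemma stable_trajectory E n :
  (forall x, x \in E -> K x) -> forall t, t \in trajectory phi E n -> K t.
Proof.
move=> EK; elim: n => [|n IH] t.
  by rewrite trajectory0 inE => /eqP ->; exact: stable_normal1 nK.
case/trajectorySP => u /IH uK [e /EK eK ->].
by apply: (stable_normalM nK) => //; exact: stable_iter.
Qed.

(** An abelian torsion group is locally finite: adjoin the elements of [D] one
    by one, each together with its finitely many powers. *)
Lemma finite_subgroup_mod D : (forall x, x \in D -> K x) ->
  exists E, [/\ (D `<=` E)%fset, 1 \in E, forall x, x \in E -> K x &
    forall x y, x \in E -> y \in E -> mem_mod L E (x * y)].
Proof.
have gen (s : seq G) : (forall x, x \in s -> K x) ->
  exists E, [/\ {subset s <= E}, 1 \in E, forall x, x \in E -> K x &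
    forall x y, x \in E -> y \in E -> mem_mod L E (x * y)].
  elim: s => [_|x s IH sK].
    exists [fset 1]%fset; split=> //; first by rewrite inE.
      by move=> x /fset1P ->; exact: stable_normal1 nK.
    move=> x y /fset1P -> /fset1P ->; rewrite mulg1.
    by apply: (mem_mod_refl nL); rewrite inE.
  have [|E [sE E1 EK EM]] := IH.
    by move=> y ys; apply: sK; rewrite inE ys orbT.
  have xK : K x by apply: sK; rewrite inE eqxx.
  have [n n0 xn1] := torsG x.
  pose E' := fset_mulg E [fset x ^+ i | i in iota 0 n]%fset.
  have E'P e i : e \in E -> e * x ^+ i \in E'.
    move=> eE; apply: mem_fset_mulg => //; apply/imfsetP.
    exists (i %% n)%N; first by rewrite /= mem_iota add0n ltn_mod.
    by rewrite {1}(divn_eq i n) expgnDr mulnC expgnA xn1 expg1n mul1g.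
  have xiK i : K (x ^+ i).
    elim: i => [|i IHi]; first by rewrite expg0; exact: stable_normal1 nK.
    by rewrite expgS; exact: (stable_normalM nK).
  exists E'; split.
  - move=> y; rewrite inE => /orP[/eqP ->|/sE yE].
      by rewrite -(mul1g x) -(expg1 x); exact: E'P.
    by rewrite -(mulg1 y) -(expg0 x); exact: E'P.
  - by rewrite -(mulg1 1) -{2}(expg0 x); exact: E'P.
  - move=> y /mem_fset_mulgP[e eE [z /imfsetP[i _ ->] ->]].
    by apply: (stable_normalM nK) => //; exact: EK.
  - move=> a b /mem_fset_mulgP[e eE [_ /imfsetP[i _ ->] ->]].
    move=> /mem_fset_mulgP[e' e'E [_ /imfsetP[j _ ->] ->]].
    have [e'' e''E ee'] := EM _ _ eE e'E.
    exists (e'' * x ^+ (i + j)); first exact: E'P.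
    apply: (eqmod_trans nL (y := e * (e' * x ^+ i) * x ^+ j)).
      rewrite -!mulgA; apply: (eqmodMl nL); rewrite !mulgA.
      by apply: (eqmodMr nL); apply: central_commute; exact: EK.
    by rewrite expgnDr !mulgA; do 2 apply: (eqmodMr nL).
by move=> /gen[E [DE E1 EK EM]]; exists E; split=> //; apply/fsubsetP.
Qed.

Section FiniteSubgroup.
Variable E : {fset G}.
Hypotheses (EK : forall x, x \in E -> K x) (E1 : 1 \in E).
Hypothesis EM : forall x y, x \in E -> y \in E -> mem_mod L E (x * y).
Local Notation T := (trajectory phi E).

(** Letters of [E] commute modulo [L], so two words can be merged letter by
    letter. *)
Lemma trajectory_modM n x y :
  mem_mod L (T n) x -> mem_mod L (T n) y -> mem_mod L (T n) (x * y).
Proof.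
have TM : forall t u, t \in T n -> u \in T n -> mem_mod L (T n) (t * u).
  elim: n => [|n IH] t u.
    by rewrite trajectory0 => /fset1P -> /fset1P ->; rewrite mulg1;
      apply: (mem_mod_refl nL); rewrite inE.
  move=> /trajectorySP[t' t'T [e eE ->]] /trajectorySP[u' u'T [f fE ->]].
  have [v vT tuv] := IH _ _ t'T u'T; have [g gE efg] := EM eE fE.
  exists (v * iter n phi g); first exact: mem_trajectoryS.
  apply: (eqmod_trans nL (y := t' * (u' * iter n phi e) * iter n phi f)).
    rewrite -!mulgA; apply: (eqmodMl nL); rewrite !mulgA; apply: (eqmodMr nL).
    by apply: central_commute; exact: stable_trajectory u'T.
  rewrite -!mulgA mulgA -iter_phiM; apply: (eqmodM nL) => //.
  exact: eqmod_iter.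
move=> [t tT xt] [u uT yu]; have [v vT tuv] := TM _ _ tT uT.
by exists v => //; apply: (eqmod_trans nL) tuv; exact: (eqmodM nL).
Qed.

(** The inverse of a torsion element is one of its powers. *)
Lemma trajectory_modV n x : mem_mod L (T n) x -> mem_mod L (T n) x^-1.
Proof.
move=> xT; have [[//|m] _ xm1] := torsG x.
rewrite (@mulg1_eq _ x (x ^+ m)) -?expgS//.
elim: {xm1} m => [|m IH]; last by rewrite expgS; exact: trajectory_modM.
by apply: (mem_mod_refl nL); exact: trajectory1.
Qed.

Lemma trajectory_mod_iter n j x : mem_mod L (T n) x ->
  mem_mod L (T (j + n)) (iter j phi x).
Proof.
move=> xT; elim: j => // j [t tT xt]; rewrite addSn iterS.
exists (phi t); first exact: trajectory_shift.
exact: (eqmod_iter nL 1).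
Qed.

(** Equivalence modulo the subgroup of those [z] for which, for some [n],
    [phi^n z] is congruent to a word in the letters of rank below [n]. On [E]
    and for large [n] this is the kernel of the map induced by [phi^n] from [E]
    to [T_(n+1)(E) / T_n(E)], so that the number of classes in [E] is the
    eventual growth ratio. *)
Definition absorbed x y :=
  exists n, mem_mod L (T n) (iter n phi (y * x^-1)).

Lemma absorbed_refl x : absorbed x x.
Proof.
exists 0%N => /=; rewrite mulgV; apply: (mem_mod_refl nL).
exact: trajectory1.
Qed.

Lemma absorbed_sym x y : absorbed x y -> absorbed y x.
Proof.
move=> [n /trajectory_modV]; rewrite -iter_phiV invgM invgK => h.
by exists n.
Qed.

(** [S] is a transversal of [E] for [absorbed]. A letter differs from its
    representative by an absorbed one, which can be moved into the earlier part
    once the rank bounds the finitely many ranks involved. Conversely two words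
    in letters of [S] that are congruent have equal last letters, because their
    quotient is absorbed, hence are equal by induction; so the words in [S]
    already realise [#|` S| ^ n] classes. *)
Lemma finite_subgroup_growth : exists S,
  (exists k, pushes phi L E S k) /\ grows phi L E S.
Proof.
have [S [SE cov sepS]] := seq_transversal E absorbed_refl absorbed_sym.
exists S; split.
  pose P e n := exists2 s, s \in S & mem_mod L (T n) (iter n phi (e * s^-1)).
  have mono e m n : (m <= n)%N -> P e m -> P e n.
    move=> mn [s sS /(trajectory_mod_iter (n - m))].
    by rewrite -iterD subnK// => h; exists s.
  have [|k Pk] := uniform_bound mono (E := E).
    by move=> e /cov[s sS [n h]]; exists n; exists s.
  exists k => x /trajectorySP[t tT [e /Pk[s sS set] ->]].
  have [v vT tv] := trajectory_modM (mem_mod_refl nL tT) set.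
  exists v => //; exists s => //; apply: (eqmod_trans nL); last first.
    exact: (eqmodMr nL) tv.
  by apply: (eqmod_eq nL); rewrite -mulgA -iter_phiM mulgVK.
move=> n; suff [sep card sub] : [/\ separated L (trajectory phi S n),
    #|` trajectory phi S n| = (#|` S| ^ n)%N &
    (trajectory phi S n `<=` T n)%fset].
  by exists (trajectory phi S n); rewrite card.
have sub m : (trajectory phi S m `<=` T m)%fset.
  by apply: trajectory_sub; apply/fsubsetP.
elim: n => [|n [sep card _]].
  by rewrite !trajectory0 cardfs1; split=> // x y /fset1P -> /fset1P ->.
have inj t t' s s' : t \in trajectory phi S n -> t' \in trajectory phi S n ->
    s \in S -> s' \in S ->
    eqmod L (t * iter n phi s) (t' * iter n phi s') -> t = t' /\ s = s'.
  move=> tT t'T sS s'S tts.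
  have ss' : s = s'.
    apply: sepS => //; exists n.
    apply: (mem_mod_eqmod nL (y := t'^-1 * t)).
      have := eqmodMr nL (iter n phi s^-1) (eqmodMl nL t'^-1 tts).
      rewrite -!mulgA -!iter_phiM mulgV iter_phi1 mulg1 (mulgA t'^-1) mulVg mul1g.
      exact: (eqmod_sym nL).
    apply: trajectory_modM; first apply: trajectory_modV;
      apply: (mem_mod_refl nL); exact: (fsubsetP (sub n)).
  split=> //; apply: sep => //; move: tts; rewrite ss' => /(eqmodMr nL) h.
  by have := h (iter n phi s')^-1; rewrite !mulgK.
split=> //.
  move=> a b /trajectorySP[t tT [s sS ->]] /trajectorySP[t' t'T [s' s'S ->]].
  by move=> /inj[]// -> ->.
rewrite trajectorySr card_fset_mulg_inj ?card ?expnSr.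
  congr (_ * _)%N; apply/eqP/card_in_imfsetP => s s' sS s'S ss'.
  have /fset0Pn[t tT] : trajectory phi S n != fset0.
    by apply: trajectory_neq0; apply/fset0Pn; exists s.
  have [|] := inj t t s s' tT tT sS s'S => //.
  by rewrite ss'; exact: (eqmod_refl nL).
move=> t t' a b tT t'T /imfsetP[s sS ->] /imfsetP[s' s'S ->] tts.
by have [|-> ->] := inj t t' s s' tT t'T sS s'S; first exact: (eqmod_eq nL).
Qed.

End FiniteSubgroup.

Hypothesis LK : forall x, L x -> K x.

(** The key step: sharp growth modulo [K] lifts to sharp growth modulo [L] when
    [K / L] is central. The new set is [F1 E], where [E] is a finite subgroup
    of [K] modulo [L] large enough to contain all the corrections that make the
    inclusion for [F1], valid modulo [K], exact. *)
Lemma tame_central_extension : tame phi K -> tame phi L.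
Proof.
move=> tK F0; have [F1 [S1 [F01 [k push1] grow1]]] := tK F0.
(* The corrections: the finitely many ways in which a word of length [k + 1]
   differs, within [K], from a word ending in [S1]. *)
pose D := [fset d in [fset b^-1 * u | b in fset_mulg (trajectory phi F1 k)
    [fset iter k phi s | s in S1], u in trajectory phi F1 k.+1]
    | `[< K d >]]%fset.
have [|E [DE E1 EK EM]] := @finite_subgroup_mod D.
  by move=> d; rewrite !inE => /andP[_ /asboolP].
have [S2 [[l push2] grow2]] := finite_subgroup_growth EK E1 EM.
pose F := fset_mulg F1 E.
have TK n t : t \in trajectory phi E n -> K t by exact: stable_trajectory.
have swap a f b e : K b -> eqmod L (a * b * (f * e)) (a * f * (b * e)).
  move=> bK; rewrite -!mulgA; apply: (eqmodMl nL); rewrite !mulgA.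
  by apply: (eqmodMr nL); apply: (eqmod_sym nL); exact: central_commute.
(* Centrality makes the trajectory of [F1 E] equal, modulo [L], to the product
   of the trajectories of [F1] and of [E]: here is one inclusion, and
   [join_traj] is the other. *)
have split_traj n x : x \in trajectory phi F n ->
    exists2 a, a \in trajectory phi F1 n &
      exists2 b, b \in trajectory phi E n & eqmod L x (a * b).
  elim: n x => [|n IH] x.
    rewrite trajectory0 => /fset1P ->; exists 1; rewrite ?trajectory0 ?inE//.
    by exists 1; rewrite ?trajectory0 ?inE// mulg1; exact: (eqmod_refl nL).
  case/trajectorySP => t /IH[a aT [b bT tab]] [_ /mem_fset_mulgP[f fF [e eE ->]]].
  move=> ->; exists (a * iter n phi f); first exact: mem_trajectoryS.
  exists (b * iter n phi e); first exact: mem_trajectoryS.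
  rewrite iter_phiM; apply: (eqmod_trans nL) (swap _ _ _ _ (TK _ _ bT)).
  exact: (eqmodMr nL).
have join_traj n a b : a \in trajectory phi F1 n -> b \in trajectory phi E n ->
    mem_mod L (trajectory phi F n) (a * b).
  elim: n a b => [|n IH] a b.
    rewrite !trajectory0 => /fset1P -> /fset1P ->; rewrite mulg1.
    by apply: (mem_mod_refl nL); rewrite inE.
  case/trajectorySP => a' a'T [f fF ->] /trajectorySP[b' b'T [e eE ->]].
  have [t tT abt] := IH _ _ a'T b'T.
  exists (t * iter n phi (f * e)).
    by apply: mem_trajectoryS => //; exact: mem_fset_mulg.
  rewrite iter_phiM; apply: (eqmod_trans nL).
    exact: (eqmod_sym nL) (swap _ _ _ _ (TK _ _ b'T)).
  exact: (eqmodMr nL).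
exists F, (fset_mulg S1 S2); split.
- apply/fsubsetP => f /(fsubsetP F01) fF; rewrite -(mulg1 f).
  exact: mem_fset_mulg.
(* [k] is the rank for [F1] and [l] the rank for [E]; both inclusions persist
   at the common rank [l + k]. *)
- exists (l + k)%N => x /split_traj[a].
  rewrite -addnS => /trajectoryDP[t tT [u uT ->]] [b bT xab].
  have [v vT [s sS uvs]] := push1 _ uT.
  pose d := (v * iter k phi s)^-1 * u.
  have dE : d \in E.
    apply: (fsubsetP DE); rewrite !inE /=; apply/andP; split; last first.
      by apply/asboolP; exact: (eqmod_sym nK).
    apply/imfset2P; exists (v * iter k phi s).
      by apply: mem_fset_mulg => //; apply/imfsetP; exists s.
    by exists u.
  have dbT : mem_mod L (trajectory phi E (l + k).+1) (iter l phi d * b).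
    apply: (trajectory_modM EK EM); apply: (mem_mod_refl nL).
      by apply: iter_mem_trajectory => //; rewrite ltnS leq_addr.
    by rewrite -addnS.
  have [b' b'T dbb'] := dbT.
  have [c cT [s' s'S b'cs']] : exists2 t, t \in trajectory phi E (l + k) &
      exists2 s, s \in S2 & eqmod L b' (t * iter (l + k) phi s).
    by have := pushesD nL push2 (j := k); rewrite addnC; exact.
  have [w wT acw] := join_traj _ _ _ (mem_trajectoryD tT vT) cT.
  exists w => //; exists (s * s'); first exact: mem_fset_mulg.
  apply: (eqmod_trans nL xab).
  have -> : t * iter l phi u * b =
      t * iter l phi v * iter (l + k) phi s * (iter l phi d * b).
    rewrite -!mulgA; congr (_ * _); rewrite !mulgA iterD -!iter_phiM.
    by rewrite /d mulgA mulgV mul1g.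
  apply: (eqmod_trans nL (eqmodMl nL _ (eqmod_trans nL dbb' b'cs'))).
  rewrite iter_phiM; apply: (eqmod_trans nL) (eqmodMr nL _ acw).
  apply: (eqmod_sym nL); exact: swap (TK _ _ cT).
- move=> n; have [U1 [sep1 card1 sub1]] := grow1 n.
  have [U2 [sep2 card2 sub2]] := grow2 n.
  have U2K u : u \in U2 -> K u by move=> /(fsubsetP sub2); exact: TK.
  have inj u u' v v' : u \in U1 -> u' \in U1 -> v \in U2 -> v' \in U2 ->
      eqmod L (u * v) (u' * v') -> u = u' /\ v = v'.
    move=> uU u'U vU v'U uv.
    have modK w z : K z -> eqmod K (w * z) w.
      by move=> /(stable_normalV nK); rewrite /eqmod invgM mulgVK.
    have uu' : u = u'.
      apply: sep1 => //; apply: (eqmod_trans nK (eqmod_sym nK (modK u v _))).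
        exact: U2K.
      by apply: (eqmod_trans nK (LK uv)); apply: modK; exact: U2K.
    split=> //; apply: sep2 => //; move: uv; rewrite uu' => /(eqmodMl nL u'^-1).
    by rewrite !mulKg.
  have [||U [subU sepU cardU]] := @separated_lift _ phi _ nL
    (fset_mulg U1 U2) (trajectory phi F n).
  + move=> x y /mem_fset_mulgP[u uU [v vU ->]].
    move=> /mem_fset_mulgP[u' u'U [v' v'U ->]].
    by move=> /inj[]// -> ->.
  + move=> x /mem_fset_mulgP[u uU [v vU ->]].
    by apply: join_traj; [exact: (fsubsetP sub1)|exact: (fsubsetP sub2)].
  exists U; split=> //; rewrite cardU (card_fset_mulg_inj (A := U1)).
    apply: (leq_trans _ (leq_mul card1 card2)); rewrite -expnMn.
    have [->|n0] := posnP n; first by rewrite !expn0.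
    by rewrite leq_exp2r// card_fset_mulg_le.
  move=> u u' v v' uU u'U vU v'U uv; apply: inj => //.
  exact: (eqmod_eq nL).
Qed.

End CentralLayer.

(** * A phi-stable central series *)

Section UpperCentral.
Variable G : groupType.
Local Open Scope group_scope.
Local Notation Z := (@upper_central G).

Lemma upper_centralP n :
  [/\ Z n 1, forall x y, Z n x -> Z n y -> Z n (x * y),
      forall x, Z n x -> Z n x^-1 & forall x y, Z n x -> Z n (x ^ y)].
Proof.
elim: n => [|n [Z1 ZM ZV ZJ]] /=.
  split=> // [x y -> ->|x ->|x y ->]; by rewrite ?mulg1 ?invg1 ?conj1g.
have comJ (x y z : G) : [~ x ^ y, z] = [~ x, z ^ y^-1] ^ y.
  by rewrite conjRg conjgKV.
split=> [y|x y Zx Zy z|x Zx y|x y Zx z]; first by rewrite comm1g.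
- have -> : [~ x * y, z] = [~ x, z] ^ y * [~ y, z].
    by rewrite /commg /conjg !invgM !mulgA !(mulgK, mulgVK).
  by apply: ZM => //; exact: ZJ.
- have -> : [~ x^-1, y] = ([~ x, y] ^ x^-1)^-1.
    by rewrite /commg /conjg !invgM !invgK !mulgA !(mulgK, mulgVK).
  by apply: ZV; exact: ZJ.
- by rewrite comJ; exact: ZJ.
Qed.

Lemma upper_central_sub n x : Z n x -> Z n.+1 x.
Proof.
have [_ ZM ZV ZJ] := upper_centralP n.
by move=> Zx y; apply: ZM; [exact: ZV|exact: ZJ].
Qed.

Variable phi : {multiplicative G -> G}.

(** The largest [phi]-stable part of the [n]-th term of the upper central
    series, which is itself not [phi]-stable in general. *)
Definition stable_central n : set G := fun x => forall i, Z n (iter i phi x).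

Lemma stable_central_normal n : stable_normal phi (stable_central n).
Proof.
have [Z1 ZM ZV ZJ] := upper_centralP n.
split=> [i|x y Zx Zy i|x Zx i|x y Zx i|x Zx i].
- by rewrite iter_phi1.
- by rewrite iter_phiM; exact: ZM.
- by rewrite iter_phiV; exact: ZV.
- by rewrite /conjg !iter_phiM iter_phiV; exact: ZJ.
- by rewrite -iterSr.
Qed.

Lemma stable_central_comm n x y :
  stable_central n.+1 x -> stable_central n [~ x, y].
Proof.
move=> Zx i; rewrite /commg /conjg !iter_phiM !iter_phiV.
exact: Zx.
Qed.

Lemma stable_central_sub n x : stable_central n x -> stable_central n.+1 x.
Proof. by move=> Zx i; exact: upper_central_sub. Qed.

(** Everything is congruent modulo the whole group, so the trajectories have a
    single class and [S] can be the unit alone. The unit is adjoined to [F0] in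
    order that the trajectories are non-empty. *)
Lemma tame_setT : tame phi setT.
Proof.
move=> F0; exists (1 |` F0)%fset, [fset 1]%fset; split.
- exact: fsubsetUr.
- exists 0%N => x xT; exists 1; first by rewrite trajectory0 inE.
  by exists 1; rewrite ?inE.
- move=> n; exists [fset 1]%fset; rewrite cardfs1 exp1n; split=> //.
    by move=> x y /fset1P -> /fset1P ->.
  by rewrite fsub1set trajectory1// !inE eqxx.
Qed.

Lemma tame_trivial : torsion G -> nilpotent_group G ->
  tame phi (stable_central 0).
Proof.
move=> torsG [c Zc].
have : tame phi (stable_central c).
  have -> : stable_central c = setT; last exact: tame_setT.
  by apply/seteqP; split=> // x _ i; rewrite Zc.
elim: c {Zc} => // c IH tc; apply: IH.
apply: (tame_central_extension torsG (stable_central_normal _)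
  (stable_central_normal _) _ _ tc).
  by move=> x y; exact: stable_central_comm.
exact: stable_central_sub.
Qed.

(** At the bottom of the series congruence is equality, so tameness bounds the
    actual cardinals on both sides. *)
Lemma trajectory_card_growth (F0 : {fset G}) :
  torsion G -> nilpotent_group G -> F0 != fset0 ->
  exists F : {fset G}, exists m C k, [/\ (F0 `<=` F)%fset, (0 < m)%N, (0 < C)%N,
    forall n, (m ^ n <= #|` trajectory phi F n|)%N &
    forall n, (k <= n)%N -> (#|` trajectory phi F n| <= C * m ^ n)%N].
Proof.
move=> torsG nilG F0n0.
have [F [S [F0F [k push] grow]]] := tame_trivial torsG nilG F0.
have Fn0 : F != fset0.
  by apply: contra_neq F0n0 => F0'; apply/eqP; rewrite -fsubset0 -F0'.
have eq0 x y : eqmod (stable_central 0) x y -> x = y.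
  by move=> /(_ 0%N)/mulg1_eq; rewrite invgK.
have S0 : (0 < #|` S|)%N.
  have /fset0Pn[x /push[t _ [s sS _]]] := trajectory_neq0 phi k.+1 Fn0.
  by rewrite cardfs_gt0; apply/fset0Pn; exists s.
have T0 n : (0 < #|` trajectory phi F n|)%N.
  by rewrite cardfs_gt0 trajectory_neq0.
exists F, #|` S|, #|` trajectory phi F k|, k; split=> // n.
  by have [U [_ card sub]] := grow n; rewrite (leq_trans card)// fsubset_leq_card.
move=> kn; rewrite -(subnK kn); elim: (n - k)%N => [|j IH].
  by rewrite add0n leq_pmulr// expn_gt0 S0.
rewrite addSn expnSr mulnA.
apply: leq_trans (_ : (#|` trajectory phi F (j + k)| * #|` S| <= _)%N); last first.
  by rewrite leq_mul2r IH orbT.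
pose Sj := [fset iter (j + k) phi s | s in S]%fset.
apply: (leq_trans (n := #|` fset_mulg (trajectory phi F (j + k)) Sj|)).
  apply: fsubset_leq_card; apply/fsubsetP => x.
  have pushj := pushesD (stable_central_normal 0) push.
  move=> /(pushj j)[t tT [s sS /eq0 ->]].
  by apply: mem_fset_mulg => //; apply/imfsetP; exists s.
apply: (leq_trans (card_fset_mulg_le _ _)); rewrite leq_mul2l.
by rewrite (leq_trans (leq_imfset_card _ _ _)) ?orbT.
Qed.

End UpperCentral.

(** * From cardinals to entropy *)

Section Asymptotics.
Variable R : realType.
Local Open Scope ring_scope.
Import numFieldNormedType.Exports.
Local Open Scope classical_set_scope.

Lemma le_limn_esup (u v : (\bar R)^nat) :
  (forall n, u n <= v n)%E -> (limn_esup u <= limn_esup v)%E.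
Proof.
move=> uv; rewrite /limn_esup !limf_esupE; apply/ereal_infP => _ [V FV <-].
apply: ge_ereal_inf; exists (ereal_sup [set u x | x in V]); first by exists V.
apply/ereal_supP => _ [n Vn <-]; apply: (le_trans (uv n)).
by apply: ereal_sup_ubound; exists n.
Qed.

Lemma limn_esup_ln_growth (a : nat -> nat) (m C k : nat) :
  (0 < m)%N -> (0 < C)%N -> (forall n, (m ^ n <= a n)%N) ->
  (forall n, (k <= n)%N -> (a n <= C * m ^ n)%N) ->
  limn_esup (fun n => (ln ((a n)%:R : R) / n%:R)%:E) = (ln (m%:R : R))%:E.
Proof.
move=> m0 C0 lo up.
suff cvg : (fun n => ln ((a n)%:R : R) / n%:R) @ \oo --> ln (m%:R : R).
  have := @cvg_limn_einf_sup R (fun n => (ln ((a n)%:R : R) / n%:R)%:E)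
    (ln (m%:R : R))%:E.
  by case=> //; apply: cvg_EFin => //; near=> n.
have pos (b : nat) : (0 < b)%N -> (b%:R : R) \is Num.pos.
  by move=> b0; rewrite posrE ltr0n.
have an0 n : (0 < a n)%N by rewrite (leq_trans _ (lo n))// expn_gt0 m0.
apply: (@squeeze_cvgr _ _ _ _ (fun=> ln (m%:R : R))
  (fun n => ln (C%:R : R) * n%:R^-1 + ln (m%:R : R))).
- near=> n.
  have n0 : (0 < n)%N by near: n; exact: nbhs_infty_gt.
  rewrite ler_pdivlMr ?ltr0n// ler_pdivrMr ?ltr0n//.
  rewrite mulrDl mulfVK ?pnatr_eq0 -?lt0n//.
  rewrite !mulr_natr -lnXn ?ltr0n// -lnM ?posrE ?exprn_gt0 ?ltr0n//.
  rewrite -natrX -natrM !ler_ln ?pos ?muln_gt0 ?expn_gt0 ?m0 ?C0// !ler_nat lo/=.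
  by apply: up; near: n; exact: nbhs_infty_ge.
- exact: cvg_cst.
- rewrite -[X in _ --> X]add0r -(mulr0 (ln (C%:R : R))).
  apply: cvgD; last exact: cvg_cst.
  apply: cvgM; first exact: cvg_cst.
  by rewrite -cvg_shiftS; exact: cvg_harmonic.
Unshelve. all: by end_near. Qed.

(** Logarithms of integers are discrete below any finite bound, hence a bounded
    family of them has a greatest element. *)
Lemma ln_nat_sup_attained (P : nat -> Prop) (h : \bar R) : (h < +oo)%E ->
  (exists n, P n) -> (forall n, P n -> (0 < n)%N) ->
  (forall n, P n -> ((ln (n%:R : R))%:E <= h)%E) ->
  exists2 m, P m & forall n, P n -> (n <= m)%N.
Proof.
move=> hoo [n0 Pn0] P0 Ph.
have [r hr] : exists r : R, forall n, P n -> ln (n%:R : R) <= r.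
  case: h hoo Ph => [r|//|] _ Ph; first by exists r => n /Ph; rewrite lee_fin.
  by have := Ph _ Pn0.
have ub n : `[< P n >] -> (n <= Num.truncn (expR r))%N.
  move=> /asboolP Pn; rewrite truncn_ge_nat ?expR_ge0//.
  by rewrite -(lnK (x := n%:R)) ?posrE ?ltr0n ?P0// ler_expR hr.
have ex : exists n, `[< P n >] by exists n0; apply/asboolP.
case: (ex_maxnP ex ub) => m /asboolP Pm max; exists m => // n Pn.
by apply: max; apply/asboolP.
Qed.

End Asymptotics.

Unset Implicit Arguments.

Theorem corollary4p8 (R : realType) (G : groupType)
    (phi : {multiplicative G -> G})
    (torsG : torsion G) (nilG : nilpotent_group G)
    (hfin : (algebraic_entropy R phi < +oo)%E) :
  exists2 alpha : nat, (0 < alpha)%N &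
    algebraic_entropy R phi = (ln (alpha%:R : R))%:E.
Proof.
pose P m := (0 < m)%N /\
  exists2 F : {fset G}, F != fset0 & entropy_at R phi F = (ln (m%:R : R))%:E.
have cofinal (F0 : {fset G}) : F0 != fset0 ->
    exists2 m, P m & (entropy_at R phi F0 <= (ln (m%:R : R))%:E)%E.
  move=> F0n0.
  have [F [m [C [k [F0F m0 C0 lo up]]]]] :=
    trajectory_card_growth phi torsG nilG F0n0.
  have hF : entropy_at R phi F = (ln (m%:R : R))%:E.
    exact: limn_esup_ln_growth m0 C0 lo up.
  exists m.
    split=> //; exists F => //; apply: contraNneq F0n0 => F0'.
    by rewrite -fsubset0 -F0'.
  rewrite -hF; apply: le_limn_esup => n; rewrite lee_fin.
  rewrite ler_wpM2r ?invr_ge0 ?ler0n// ler_ln ?posrE ?ltr0n ?cardfs_gt0.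
  - by rewrite ler_nat fsubset_leq_card// trajectory_sub.
  - exact: trajectory_neq0.
  - apply: trajectory_neq0; apply: contraNneq F0n0 => F0'.
    by rewrite -fsubset0 -F0'.
have [|||m [m0 [F Fn0 hF]] max] := @ln_nat_sup_attained R P _ hfin.
- have [|m Pm _] := cofinal [fset 1%g]%fset; last by exists m.
  by apply/fset0Pn; exists 1%g; rewrite inE.
- by move=> n [].
- by move=> n [_ [F Fn0 <-]]; apply: ereal_sup_ubound; exists F.
exists m => //; apply/le_anti/andP; split.
  apply/ereal_supP => _ [F0 /cofinal[n Pn hn] <-]; apply: (le_trans hn).
  have n0 : (0 < n)%N by case: Pn.
  by rewrite lee_fin ler_ln ?posrE ?ltr0n// ler_nat max.
by rewrite -hF; apply: ereal_sup_ubound; exists F.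
Qed.
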